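(* Let $I\subseteq\mathbb{R}$ be an interval and let $f:I\to\mathbb{R}$ be such that $f'':I\to\mathbb{R}$ is an absolutely continuous function on the interior $I^{\circ}$ and $f'''\in L[a,b]$, where $a,b\in I$, $a<b$. Let $q\geq 1$. If $|f'''|^{q}$ belongs to $Q(I)$, then $$\left|\frac{f(a)+f(b)}{2}-\frac{1}{b-a}\int_{a}^{b}f(x)\,dx-\frac{b-a}{12}\left[f'(b)-f'(a)\right]\right|\leq \frac{(b-a)^{3}}{12}\left(\frac{1}{16}\right)^{1-\frac{1}{q}}\left[\frac{|f'''(a)|^{q}+|f'''(b)|^{q}}{4}\right]^{\frac{1}{q}}.$$
   Context: Godunova-Levin class: a map $g:I\to\mathbb{R}$ is said to belong to the class $Q(I)$ if it is nonnegative and for all $x,y\in I$ and $\lambda\in(0,1)$ it satisfies $g(\lambda x+(1-\lambda)y)\leq \frac{g(x)}{\lambda}+\frac{g(y)}{1-\lambda}$. $L[a,b]$ denotes the space of Lebesgue integrable functions on $[a,b]$. *)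

(* Defs.v *)
From HB Require Import structures.
From mathcomp Require Import all_boot all_order all_algebra.
From mathcomp Require Import all_classical all_reals all_analysis.

Set Implicit Arguments.
Unset Strict Implicit.
Unset Printing Implicit Defensive.

Import Order.TTheory GRing.Theory Num.Theory.
Import numFieldNormedType.Exports.

Local Open Scope classical_set_scope.
Local Open Scope ring_scope.

(* A function on I is represented by a total function R -> R; every notion
   below depends only on its values on I. *)

(* The difference quotient is restricted to I: this is the usual derivative at
   interior points of I and the one-sided derivative at an endpoint in I. *)
Definition has_derivative_within (R : realType) (I : set R) (f : R -> R)
    (x l : R) : Prop :=
  (fun y => (f y - f x) / (y - x)) @ within I x^' --> l.

Definition derivative_on (R : realType) (I : set R) (f df : R -> R) : Prop :=
  forall x, I x -> has_derivative_within I f x (df x).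

(* df agrees with the derivative of f at each point of I where f is
   differentiable and is unconstrained at the other points.  An absolutely
   continuous f is only differentiable almost everywhere, so this is the sense
   in which its derivative is a function on all of I. *)
Definition extends_derivative_on (R : realType) (I : set R) (f df : R -> R)
    : Prop :=
  forall x l, I x -> has_derivative_within I f x l -> df x = l.

(* J is meant to be an interval, so that x i, y i in J means [x i, y i] is
   contained in J. *)
Definition absolutely_continuous_on (R : realType) (J : set R) (f : R -> R)
    : Prop :=
  forall e : R, 0 < e -> exists2 d : R, 0 < d &
    forall (n : nat) (x y : 'I_n -> R),
      (forall i, [/\ J (x i), J (y i) & x i < y i]) ->
      trivIset setT (fun i => `]x i, y i[%classic) ->
      \sum_(i < n) (y i - x i) < d ->
      \sum_(i < n) `|f (y i) - f (x i)| < e.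

(* The Godunova-Levin class Q(I). *)
Definition godunova_levin (R : realType) (I : set R) (g : R -> R) : Prop :=
  (forall x, I x -> 0 <= g x) /\
  (forall x y t : R, I x -> I y -> 0 < t -> t < 1 ->
    g (t * x + (1 - t) * y) <= g x / t + g y / (1 - t)).

(* Main.v *)
(** Absolute continuity serves only to compare [f2] with an explicit function
    [N] satisfying [|f3| <= N'].  For this it is enough that an absolutely
    continuous [G] whose derivative is nonnegative wherever it exists satisfies
    [G c <= G d]: [G] is the difference of two monotone functions (the total
    variation [T] of [G] and [T - G]) that are absolutely continuous, hence, by
    Radon-Nikodym applied to their Lebesgue-Stieltjes measures, indefinite
    integrals, and the Lebesgue differentiation theorem identifies the density
    of [G] with its derivative almost everywhere.

    Hoelder's inequality is replaced by a tangent line.  Put [h = b - a],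
    [A = |f3 a| `^ q] and [B = |f3 b| `^ q]: the Godunova-Levin inequality
    between [a] and [b] and the concavity of [x `^ (1 / q)] bound
    [|f3 x|] by [al * (A * h / (b - x) + B * h / (x - a)) + be], for which the
    remaining integrals are explicit.

    Finally, with [m] the midpoint of [[a, b]], consider the error on
    [[m - s, m + s]],
      [E s = s (f (m+s) + f (m-s)) - \int f - s^2/3 (f1 (m+s) - f1 (m-s))].
    Its derivative is [s/3 * D s] with
      [D s = f1 (m+s) - f1 (m-s) - s (f2 (m+s) + f2 (m-s))],
    so that bounds on increments of [f2] integrate to bounds on [D] and [E]. *)

Require Import Defs.
From HB Require Import structures.
From mathcomp Require Import all_boot all_order all_algebra.
From mathcomp Require Import all_classical all_reals all_analysis.
From mathcomp Require Import measurable_realfun ring lra.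

Import Order.TTheory GRing.Theory Num.Theory.
Import numFieldNormedType.Exports.

Local Open Scope classical_set_scope.
Local Open Scope ring_scope.

(** * Lists of nonoverlapping intervals and clamping *)

Definition nonoverlapping (R : realType) (s : seq (R * R)) : bool :=
  all (fun p => p.1 <= p.2) s
  && pairwise (fun p q => (p.2 <= q.1) || (q.2 <= p.1)) s.

Definition total_length (R : realType) (s : seq (R * R)) : R :=
  \sum_(p <- s) (p.2 - p.1).

(* Degenerate intervals are allowed and the conclusion is not strict, so that
   the property is stable under clamping and under suprema over partitions. *)
Definition list_absolutely_continuous (R : realType) (f : R -> R) : Prop :=
  forall e : R, 0 < e -> exists2 d : R, 0 < d &
    forall s : seq (R * R), nonoverlapping R s -> total_length R s < d ->
      \sum_(p <- s) `|f p.2 - f p.1| <= e.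

(** Composition with [clamp] extends a function from [[c, d]] to the whole line by constants;
    Stieltjes measures need functions defined everywhere. *)
Definition clamp (R : realType) (c d x : R) : R := Num.max c (Num.min d x).

Lemma clamp_itv (R : realType) (c d x : R) : c <= d ->
  c <= clamp R c d x <= d.
Proof.
by move=> cd; rewrite /clamp le_max lexx /= ge_max cd ge_min lexx.
Qed.

Lemma clamp_id (R : realType) (c d x : R) : c <= x <= d -> clamp R c d x = x.
Proof. by move=> /andP[cx xd]; rewrite /clamp min_r// max_r. Qed.

Lemma le_clamp (R : realType) (c d x y : R) : x <= y ->
  clamp R c d x <= clamp R c d y.
Proof.
move=> xy; rewrite /clamp ge_max le_max lexx /= le_max; apply/orP; right.
by rewrite le_min ge_min lexx /= ge_min xy orbT.
Qed.

Lemma clamp_contract (R : realType) (c d x y : R) : c <= d -> x <= y ->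
  clamp R c d y - clamp R c d x <= y - x.
Proof.
move=> cd xy; rewrite /clamp /Order.min /Order.max.
by case: (ltP d y) => ?; case: (ltP d x) => ?; case: ltP => ?; case: ltP => ?;
  lra.
Qed.

Lemma nonoverlapping_map_clamp (R : realType) (c d : R)
    (s : seq (R * R)) : c <= d -> nonoverlapping R s ->
  let s' := [seq (clamp R c d p.1, clamp R c d p.2) | p <- s] in
  nonoverlapping R s' /\ total_length R s' <= total_length R s.
Proof.
move=> cd /andP[os ps] s'; split; last first.
  rewrite /total_length /s' big_map /= !big_seq.
  apply: ler_sum => p ps'; apply: clamp_contract => //.
  exact: (allP os).
apply/andP; split.
  rewrite /s' all_map; apply: sub_all os => p /= ?; exact: le_clamp.
rewrite /s' pairwise_map; apply: sub_pairwise ps => p q /=.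
by case/orP => pq; apply/orP; [left|right]; apply: le_clamp.
Qed.

(** Clamping moves every interval into [J] and lengthens none. Intervals that it collapses
    contribute nothing to the sum and are filtered out, because [absolutely_continuous_on] admits
    only nondegenerate ones. *)
Lemma list_ac_clamp (R : realType) (J : set R) (f : R -> R) (c d : R) :
  c <= d -> (forall x, c <= x <= d -> J x) ->
  absolutely_continuous_on J f ->
  list_absolutely_continuous R (f \o clamp R c d).
Proof.
move=> cd cdJ acf e e0; have [r r0 H] := acf e e0; exists r => // s nos lens.
have [nos' lens'] := nonoverlapping_map_clamp R c d s cd nos.
set s' := map _ _ in nos' lens'.
pose s'' := [seq p <- s' | p.1 < p.2].
have sumE : \sum_(p <- s) `|(f \o clamp R c d) p.2 - (f \o clamp R c d) p.1|
    = \sum_(p <- s'') `|f p.2 - f p.1|.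
  rewrite /s'' big_filter [RHS]big_mkcond /s' big_map /=.
  rewrite big_seq [RHS]big_seq.
  apply: eq_bigr => p ps; case: ifPn => //; rewrite -leNgt => h.
  move/andP : nos => [/allP/(_ p ps) p12 _].
  suff -> : clamp R c d p.1 = clamp R c d p.2 by rewrite subrr normr0.
  by apply/eqP; rewrite eq_le h le_clamp.
rewrite sumE.
have nth12 (i : 'I_(size s'')) :
    [/\ nth (0, 0) s'' i \in s', (nth (0, 0) s'' i).1 < (nth (0, 0) s'' i).2 &
      nth (0, 0) s'' i \in s''].
  have := mem_nth (0, 0) (ltn_ord i); rewrite -/s'' => h; split => //.
    by move: h; rewrite mem_filter => /andP[].
  by move: h; rewrite mem_filter => /andP[].
have Js p : p \in s' -> J p.1 /\ J p.2.
  by move=> /mapP[q _ ->] /=; split; apply: cdJ; exact: clamp_itv.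
apply/ltW; rewrite (big_nth (0, 0)) big_mkord.
apply: (H (size s'') (fun i => (nth (0, 0) s'' i).1)
   (fun i => (nth (0, 0) s'' i).2)).
- by move=> i; have [/Js[? ?] ? _] := nth12 i.
- have pw : pairwise (fun p q : R * R => (p.2 <= q.1) || (q.2 <= p.1)) s''.
    move/andP : nos' => [_]; apply: subseq_pairwise; exact: filter_subseq.
  move/(pairwiseP (0, 0)) : pw => pw.
  have key (i j : 'I_(size s'')) : (i < j)%N ->
    `](nth (0, 0) s'' i).1, (nth (0, 0) s'' i).2[%classic `&`
    `](nth (0, 0) s'' j).1, (nth (0, 0) s'' j).2[%classic = set0.
    move=> ij; apply/seteqP; split => // z [] /=; rewrite !in_itv /=.
    have := pw i j (ltn_ord i) (ltn_ord j) ij.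
    case/orP => ? /andP[? ?] /andP[? ?]; lra.
  apply/trivIsetP => i j _ _ ij.
  case: (ltngtP i j) => ij'; first exact: key.
    by rewrite setIC; exact: key.
  by move: ij; rewrite -val_eqE /= ij' eqxx.
- apply: le_lt_trans lens.
  rewrite (_ : \sum_(i < _) _ = total_length R s''); last first.
    by rewrite /total_length (big_nth (0, 0)) big_mkord.
  apply: le_trans lens'.
  rewrite /total_length /s'' big_filter big_mkcond /= !big_seq.
  apply: ler_sum => p ps'; case: ifPn => // _.
  by rewrite subr_ge0; move/andP : nos' => [/allP/(_ p ps')].
Qed.

(** * Total variation of absolutely continuous functions *)

Lemma path_zip_nonoverlapping (R : realType) (s : seq R) (a b : R) :
  itv_partition a b s ->
  nonoverlapping R (zip (a :: s) s) /\
  all (fun p => (a <= p.1) && (p.2 <= b)) (zip (a :: s) s).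
Proof.
elim: s a => [|x s ih] a //= abs.
have [abs' xb] := (itv_partition_cons abs, itv_partition_le (itv_partition_cons abs)).
have ax : a <= x by case: abs => /= /andP[/ltW].
have [/andP[ord pw] al] := ih x abs'; rewrite /nonoverlapping /= ord pw ax lexx xb /= !andbT.
split; last by apply: sub_all al => p /andP[xp ->]; rewrite (le_trans ax xp).
by apply: sub_all al => p /andP[-> _].
Qed.

Lemma nonoverlapping_refine (R : realType) (L M : seq (R * R)) (x y : R)
    (t : seq R) :
  nonoverlapping R (L ++ (x, y) :: M) -> itv_partition x y t ->
  nonoverlapping R ((L ++ zip (x :: t) t) ++ M) /\
  total_length R ((L ++ zip (x :: t) t) ++ M) =
    total_length R (L ++ (x, y) :: M).
Proof.
move=> /andP[]; rewrite all_cat pairwise_cat /= => /and3P[oL oxy oM].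
rewrite allrel_consr => /and4P[/andP[Lxy LM] pL xyM pM] xyt.
have [/andP[ord pw] al] := path_zip_nonoverlapping R t x y xyt.
split.
  rewrite /nonoverlapping !all_cat oL oM ord /= !pairwise_cat pL pM pw.
  rewrite allrel_catl LM !andbT; apply/andP; split.
    apply/allrelP => p q pM' qM; have := allP al p pM' => /andP[h1 h2].
    by have := allP xyM q qM; case/orP => /= h3; apply/orP; [left|right]; lra.
  apply/allrelP => p q pM' qM; have := allP al q qM => /andP[h1 h2].
  by have := allP Lxy p pM'; case/orP => /= h3; apply/orP; [left|right]; lra.
rewrite /total_length !big_cat /= big_cons -addrA; congr (_ + (_ + _)) => /=.
elim: t x xyt {oxy Lxy xyM ord pw al} => [|z t ih] x xyt /=.
  by rewrite big_nil (itv_partition_nil xyt) subrr.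
by rewrite big_cons /= (ih _ (itv_partition_cons xyt)); ring.
Qed.

(* The intervals of [M] are replaced one at a time by the pieces of a partition,
   and the supremum over these partitions is taken at each step. *)
Lemma sum_total_variation_le (R : realType) (f : R -> R) (d e : R) :
  (forall s, nonoverlapping R s -> total_length R s < d ->
    \sum_(p <- s) `|f p.2 - f p.1| <= e) ->
  forall M L, nonoverlapping R (L ++ M) -> total_length R (L ++ M) < d ->
  ((\sum_(p <- L) `|f p.2 - f p.1|)%:E
    + \sum_(p <- M) total_variation p.1 p.2 f <= e%:E)%E.
Proof.
move=> H; elim=> [|[x y] M ih] L nos lens.
  by rewrite big_nil adde0 lee_fin; apply: H; rewrite cats0 in nos lens.
have xy : x <= y by move: nos => /andP[]; rewrite all_cat /= => /and3P[].
have M0 : (0 <= \sum_(p <- M) total_variation p.1 p.2 f)%E.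
  rewrite big_seq; apply: sume_ge0 => p pM; apply: total_variation_ge0.
  by move: nos => /andP[]; rewrite all_cat /= => /and3P[_ _ /allP h] _; exact: h.
have ih' t : itv_partition x y t ->
    ((\sum_(p <- L) `|f p.2 - f p.1|)%:E + ((variation x y f t)%:E +
    \sum_(p <- M) total_variation p.1 p.2 f) <= e%:E)%E.
  move=> xyt; have [nos' lens'] := nonoverlapping_refine R L M x y t nos xyt.
  have := ih (L ++ zip (x :: t) t) nos'; rewrite lens' => /(_ lens).
  rewrite big_cat /= EFinD -addeA; congr (_ + (_%:E + _) <= _)%E.
  rewrite variation_zip//; elim: t x {xyt nos' lens' xy nos lens} => [|z t iht] x /=.
    by rewrite !big_nil.
  by rewrite !big_cons iht.
have [t0 xyt0] : exists t, itv_partition x y t.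
  move: xy; rewrite le_eqVlt => /orP[/eqP->|xy]; first by exists [::].
  by exists [:: y]; exact: itv_partition1.
(* One partition already shows that the variation over [M] is finite, so that it can be moved to the
   other side before taking the supremum. *)
have Mfin : (\sum_(p <- M) total_variation p.1 p.2 f)%E \is a fin_num.
  rewrite ge0_fin_numE//; apply: le_lt_trans (ltry (e
     - (variation x y f t0) - \sum_(p <- L) `|f p.2 - f p.1|)).
  have := ih' t0 xyt0; case: (\sum_(p <- M) _)%E => [r| |] /=; [|by []|by move=> _; exact: leNye].
  by rewrite -!EFinD !lee_fin; lra.
rewrite big_cons /=.
suff : (total_variation x y f <= (e -
    fine (\sum_(p <- M) total_variation p.1 p.2 f)
    - \sum_(p <- L) `|f p.2 - f p.1|)%:E)%E.
  move: Mfin; case: (\sum_(p <- M) _)%E => [r| |] //= _.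
  case: (total_variation x y f) => [u| |] /=; [|by []|by move=> _; exact: leNye].
  by rewrite -!EFinD !lee_fin; lra.
apply: ge_ereal_sup => _ [_ [t xyt <-] <-].
have := ih' t xyt; move: Mfin; case: (\sum_(p <- M) _)%E => [r| |] //= _.
by rewrite -!EFinD !lee_fin; lra.
Qed.

(** The variation is at most 1 on any interval shorter than the [r] that belongs to [e = 1], and
    finitely many such intervals cover [[c, d]]. *)
Lemma list_ac_bounded_variation (R : realType) (f : R -> R) (c d : R) :
  c <= d -> list_absolutely_continuous R f ->
  total_variation c d f \is a fin_num.
Proof.
move=> cd acf; have [r r0 H] := acf 1 ltr01.
have small x y : x <= y -> y - x < r -> total_variation x y f \is a fin_num.
  move=> xy yxr; rewrite ge0_fin_numE; last exact: total_variation_ge0.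
  have := sum_total_variation_le R f r 1 H [:: (x, y)] [::].
  rewrite /nonoverlapping /total_length /= big_seq1 xy => /(_ isT yxr).
  by rewrite big_nil add0e big_seq1 /= => h; exact: le_lt_trans h (ltry _).
have step n x y : x <= y -> y - x < n%:R * r ->
    total_variation x y f \is a fin_num.
  elim: n x => [|n ih] x xy; first by rewrite mul0r subr_lt0 ltNge xy.
  rewrite -natr1 mulrDl mul1r => h.
  have [yxr|ryx] := ltP (y - x) r; first exact: small.
  have xz : x <= x + r / 2 by lra.
  have zy : x + r / 2 <= y by lra.
  (* If cutting off [r / 2] leaves too long a rest, the cut is made at the mean of [y - x - n * r]
     and [r]: the first piece stays shorter than [r] and the rest becomes shorter than [n * r]. *)
  have [nr|nr] := ltP (y - (x + r / 2)) (n%:R * r).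
    by rewrite (total_variationD f xz zy) fin_numD ih// small//; lra.
  have xz' : x <= x + (y - x - n%:R * r + r) / 2 by lra.
  have zy' : x + (y - x - n%:R * r + r) / 2 <= y by lra.
  by rewrite (total_variationD f xz' zy') fin_numD ih ?small//; lra.
apply: (step (Num.Def.truncn ((d - c) / r)).+1) => //.
by rewrite -ltr_pdivrMr// truncnS_gt.
Qed.

(** By additivity, increments of [T] are total variations of [f] over clamped intervals, and
    [sum_total_variation_le] bounds their sum by the same [e] as for [f]. *)
Lemma list_ac_total_variation (R : realType) (f : R -> R) (c d : R) :
  c <= d -> list_absolutely_continuous R f ->
  let T x := fine (total_variation c (clamp R c d x) f) in
  list_absolutely_continuous R T /\
  forall x y, c <= x -> x <= y -> y <= d -> `|f y - f x| <= T y - T x.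
Proof.
move=> cd acf T.
have TD x y : x <= y -> T y - T x =
    fine (total_variation (clamp R c d x) (clamp R c d y) f).
  move=> xy; have /andP[cx xd] := clamp_itv R c d x cd.
  have cxy := le_clamp R c d x y xy.
  rewrite /T (total_variationD f cx cxy) fineD ?list_ac_bounded_variation//.
  by rewrite addrC addKr.
have fTV x y : x <= y -> total_variation x y f \is a fin_num.
  by move=> xy; exact: list_ac_bounded_variation.
split; last first.
  move=> x y cx xy yd; rewrite TD//.
  rewrite !clamp_id ?cx ?yd ?(le_trans xy yd) ?(le_trans cx xy)//.
  by rewrite -lee_fin fineK ?fTV// total_variation_ge.
move=> e e0; have [r r0 H] := acf e e0; exists r => // s nos lens.
have [nos' lens'] := nonoverlapping_map_clamp R c d s cd nos.
set s' := map _ _ in nos' lens'.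
have := sum_total_variation_le R f r e H s' [::] nos' (le_lt_trans lens' lens).
rewrite big_nil add0e -lee_fin; apply: le_trans.
rewrite /s' big_map /= !big_seq -sumEFin; apply: lee_sum => p ps.
have p12 : p.1 <= p.2 by move/andP : nos => [/allP/(_ p ps)].
rewrite TD// ger0_norm ?fine_ge0 ?total_variation_ge0 ?le_clamp//.
by rewrite fineK// fTV// le_clamp.
Qed.

(** * Stieltjes measures of absolutely continuous functions and their densities *)

Lemma open_finite_interval (R : realType) (I : set R) :
  open I -> is_interval I -> (@lebesgue_measure R I < +oo)%E ->
  exists p : R * R, p.1 <= p.2 /\ I = `]p.1, p.2[%classic.
Proof.
move=> oI iI Ioo; have [->|/set0P I0] := eqVneq I set0.
  exists (0, 0); split => //=; apply/seteqP; split => // x /=.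
  by rewrite in_itv /= => /andP[h1 /(lt_trans h1)]; rewrite ltxx.
have := (is_intervalP I).1 iI.
case: (Rhull I) => [[b1 x|b1] [b2 y|b2]] IE.
- have {Ioo} xy : x <= y.
    case: I0 => z; rewrite IE /= in_itv => /andP[h1 h2].
    by apply: (@le_trans _ _ z); [case: b1 h1 {IE}|case: b2 h2 {IE}] => // /ltW.
  exists (x, y); split => //=.
  have xI : ~ I x.
    move=> Ix; have /nbhs_ballP[e /= e0 eI] := open_nbhs_nbhs (conj oI Ix).
    have : I (x - e / 2).
      apply: eI; rewrite /ball /= opprB addrC subrK ger0_norm; lra.
    by rewrite IE /= in_itv /= => /andP[+ _]; case: b1 {IE} => /= ?; lra.
  have yI : ~ I y.
    move=> Iy; have /nbhs_ballP[e /= e0 eI] := open_nbhs_nbhs (conj oI Iy).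
    have : I (y + e / 2).
      apply: eI; rewrite /ball /= opprD addrA subrr sub0r normrN ger0_norm; lra.
    by rewrite IE /= in_itv /= => /andP[_ +]; case: b2 {IE} => /= ?; lra.
  apply/seteqP; split => z; rewrite /= in_itv /=.
    move=> Iz; have : z != x by apply/eqP => zx; apply: xI; rewrite -zx.
    have : z != y by apply/eqP => zx; apply: yI; rewrite -zx.
    rewrite !lt_neqAle => -> /[1!eq_sym] -> /=.
    move: Iz; rewrite IE /= in_itv /= => /andP[h1 h2].
    by apply/andP; split; [case: b1 h1 {IE}|case: b2 h2 {IE}] => // /ltW.
  move=> /andP[h1 h2]; rewrite IE /= in_itv /=.
  by apply/andP; split; [case: b1 {IE}|case: b2 {IE}] => //=; exact: ltW.
- by move: Ioo; rewrite IE lebesgue_measure_itv /=; case: b2 IE => IE /=; rewrite ?ltry //;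
    case: I0 => z; rewrite IE /= in_itv /= andbF.
- by move: Ioo; rewrite IE lebesgue_measure_itv /=; case: b1 IE => IE /=; rewrite ?ltNyr //;
    case: I0 => z; rewrite IE /= in_itv.
- move: Ioo; rewrite IE lebesgue_measure_itv /=; case: b1 IE => IE /=; case: b2 IE => IE /= //;
    by case: I0 => z; rewrite IE /= in_itv.
Qed.

Lemma list_ac_continuous (R : realType) (f : R -> R) :
  list_absolutely_continuous R f -> continuous f.
Proof.
move=> acf x; apply/cvgrPdist_le => e e0; have [r r0 H] := acf e e0.
apply/nbhs_ballP; exists r => //= y; rewrite /ball /= => xy.
have [lexy|/ltW leyx] := leP x y.
  have := H [:: (x, y)]; rewrite /nonoverlapping /total_length /= lexy !big_seq1.
  by rewrite distrC; apply => //; move: xy; rewrite ltr_norml => /andP[]; rewrite /=; lra.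
have := H [:: (y, x)]; rewrite /nonoverlapping /total_length /= leyx !big_seq1.
by apply => //; move: xy; rewrite ltr_norml => /andP[]; rewrite /=; lra.
Qed.

Lemma lebesgue_stieltjes_ocitv (R : realType) (H : cumulative R R) (x y : R) :
  x <= y -> lebesgue_stieltjes_measure H `]x, y]%classic = (H y - H x)%:E.
Proof.
move=> xy; rewrite /lebesgue_stieltjes_measure /measure_extension.
rewrite measurable_mu_extE /=; last exact: is_ocitv.
by rewrite wlength_itv_bnd.
Qed.

(** A null set lies in an open set of Lebesgue measure less than [r]. Its components are disjoint
    intervals of total length less than [r], so absolute continuity bounds every finite sum of
    increments of [H] over them by [e]. *)
Lemma lebesgue_stieltjes_dominated (R : realType) (H : cumulative R R) :
  list_absolutely_continuous R H ->
  lebesgue_stieltjes_measure H `<< @lebesgue_measure R.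
Proof.
move=> acH; apply/null_content_dominatesP => A mA A0.
apply/eqP; rewrite -measure_le0; apply/lee_addgt0Pr => e e0; rewrite add0e.
have [r r0 Hr] := acH e e0.
have [|U [oU AU UAr]] := @lebesgue_regularity_outer R A r mA _ r0.
  by rewrite A0.
have mU : measurable (U : set (measurableTypeR R)) by exact: open_measurable.
have Ur : (@lebesgue_measure R U < r%:E)%E.
  rewrite -(setDUK AU) (le_lt_trans (measureU2 _ _ _))//.
    exact: measurableD.
  by rewrite A0 add0e.
pose I := open_disjoint_itv oU.
have mI k : measurable (I k : set (measurableTypeR R)).
  by apply: open_measurable; exact: open_disjoint_itv_open.
have tI : trivIset setT I by exact: open_disjoint_itv_trivIset.
have UE : U = \bigcup_k I k by exact: open_disjoint_itv_bigcup.
have /choice[p Ip] k : exists p : R * R, p.1 <= p.2 /\ I k = `]p.1, p.2[%classic.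
  apply: open_finite_interval.
  - exact: open_disjoint_itv_open.
  - exact: open_disjoint_itv_is_interval.
  - apply: le_lt_trans (lt_trans Ur (ltry r)); apply: le_measure; rewrite ?inE//.
    by rewrite UE; exact: bigcup_sup.
apply: (@le_trans _ _ (lebesgue_stieltjes_measure H U)).
  by apply: le_measure; rewrite ?inE.
have HI k : (lebesgue_stieltjes_measure H (I k) <= (H (p k).2 - H (p k).1)%:E)%E.
  have [pk Ik] := Ip k; rewrite -lebesgue_stieltjes_ocitv// Ik.
  apply: le_measure; rewrite ?inE; [exact: measurable_itv|exact: measurable_itv|].
  by apply: subset_itvl; rewrite bnd_simp.
have lI k : @lebesgue_measure R (I k) = ((p k).2 - (p k).1)%:E.
  have [pk ->] := Ip k; rewrite lebesgue_measure_itv /= lte_fin.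
  case: ltP => //= h.
  suff -> : (p k).1 = (p k).2 by rewrite subrr.
  by apply/eqP; rewrite eq_le pk.
have mbig (m : {measure set (measurableTypeR R) -> \bar R}) :
    m U = (\sum_(0 <= k <oo) m (I k))%E.
  by rewrite UE measure_bigcup//=; apply: eq_eseriesl => k; rewrite in_setT.
rewrite [leLHS](mbig (lebesgue_stieltjes_measure H)).
apply: lime_le; first by apply: is_cvg_nneseries => k _ _; exact: measure_ge0.
apply: nearW => n.
(* Empty components are dropped: their degenerate pair of endpoints may lie inside another
   component, and then the list would not be [nonoverlapping]. *)
pose s := [seq q <- [seq p k | k <- index_iota 0 n] | q.1 < q.2].
have sumE (F : R * R -> R) : (forall q, q.1 = q.2 -> F q = 0) ->
    \sum_(0 <= k < n) F (p k) = \sum_(q <- s) F q.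
  move=> F0; rewrite /s big_filter [RHS]big_mkcond big_map /=.
  apply: eq_bigr => k _; case: ltP => // h; apply: F0.
  by apply/eqP; rewrite eq_le h; have [->] := Ip k.
apply: (@le_trans _ _ (\sum_(0 <= k < n) ((H (p k).2 - H (p k).1)%:E))%E).
  by apply: lee_sum => k _; exact: HI.
rewrite sumEFin lee_fin (sumE (fun q => H q.2 - H q.1)); last first.
  by move=> q ->; rewrite subrr.
apply: (@le_trans _ _ (\sum_(q <- s) `|H q.2 - H q.1|)).
  by apply: ler_sum => q _; exact: ler_norm.
apply: Hr.
  apply/andP; split; first by apply/allP => q; rewrite mem_filter => /andP[/ltW].
  rewrite /s filter_map pairwise_map.
  have : uniq [seq k <- index_iota 0 n | (p k).1 < (p k).2].
    by rewrite filter_uniq// iota_uniq.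
  rewrite uniq_pairwise.
  have al : all (fun k => (p k).1 < (p k).2) [seq k <- index_iota 0 n | (p k).1 < (p k).2].
    exact: filter_all.
  apply: (sub_in_pairwise _ al) => i j iP jP /= ij.
  have pi12 : (p i).1 < (p i).2 := iP.
  have pj12 : (p j).1 < (p j).2 := jP.
  have /trivIsetP/(_ i j Logic.I Logic.I ij) := tI.
  have [_ ->] := Ip i; have [_ ->] := Ip j => /seteqP[h _] /=.
  rewrite !leNgt -negb_and; apply/negP => /andP[h1 h2].
  pose lo := Num.max (p i).1 (p j).1; pose hi := Num.min (p i).2 (p j).2.
  have lohi : lo < hi by rewrite gt_max !lt_min pi12 pj12 h1 h2.
  have := h ((lo + hi) / 2); apply => /=; rewrite !in_itv /=.
  have : (p i).1 <= lo by rewrite le_max lexx.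
  have : (p j).1 <= lo by rewrite le_max lexx orbT.
  have : hi <= (p i).2 by rewrite ge_min lexx.
  have : hi <= (p j).2 by rewrite ge_min lexx orbT.
  by move: lohi; move: lo hi => lo hi *; split; apply/andP; split; lra.
rewrite /total_length -(sumE (fun q => q.2 - q.1)); last first.
  by move=> q ->; rewrite subrr.
rewrite -lte_fin; apply: le_lt_trans Ur; rewrite (mbig lebesgue_measure).
rewrite -sumEFin; apply: le_trans (nneseries_lim_ge n _).
  by apply: lee_sum => k _; rewrite -lI.
by move=> k _ _; exact: measure_ge0.
Qed.

(** Radon-Nikodym is applied to the Stieltjes measure of [H] restricted to []c, d]], which makes it
    finite and its density integrable on the whole line. *)
Lemma monotone_ac_density (R : realType) (H : R -> R) (c d : R) :
  {homo H : x y / x <= y} -> list_absolutely_continuous R H ->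
  exists2 h : R -> R, (@lebesgue_measure R).-integrable setT (EFin \o h) &
    forall x, c <= x <= d ->
      H x - H c = \int[@lebesgue_measure R]_(t in `]c, x]) h t.
Proof.
move=> nd acH.
have rc : right_continuous H by apply: right_continuousW; exact: list_ac_continuous.
pose K : cumulative R R := HB.pack H (isCumulative.Build R _ R H nd rc).
have mcd : measurable (`]c, d]%classic : set (measurableTypeR R)) by [].
have cdoo : (lebesgue_stieltjes_measure K `]c, d]%classic < +oo)%E.
  have [cd|dc] := leP c d; first by rewrite lebesgue_stieltjes_ocitv// ltry.
  rewrite (_ : `]c, d]%classic = set0) ?measure0 ?ltry//.
  by rewrite set_itv_ge// bnd_simp -leNgt ltW.
pose nu : {finite_measure set _ -> \bar R} := mfrestr mcd cdoo.
have dom : nu `<< @lebesgue_measure R.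
  apply/null_content_dominatesP => A mA A0; rewrite /nu /= /mfrestr /mrestr.
  have /null_content_dominatesP := lebesgue_stieltjes_dominated R K acH.
  apply; first exact: measurableI.
  by apply/eqP; rewrite -measure_le0 -A0; apply: le_measure; rewrite ?inE//;
    exact: measurableI.
have [f [f0 ffin fint fE]] := radon_nikodym_sigma_finite dom.
have fK : EFin \o (fine \o f) = f by apply/funext => x /=; rewrite fineK.
exists (fine \o f); first by rewrite fK.
move=> x /andP[cx xd]; rewrite /Rintegral.
rewrite [X in fine X](_ : _ = nu `]c, x]%classic); last first.
  by rewrite fE//; apply: eq_integral => t _ /=; rewrite fineK.
rewrite /nu /= /mfrestr /mrestr setIidl; last by apply: subset_itvl; rewrite bnd_simp.
by rewrite lebesgue_stieltjes_ocitv.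
Qed.


Lemma ac_increasing (R : realType) (J : set R) (G : R -> R) (c d : R) :
  c <= d -> (forall x, c <= x <= d -> J x) ->
  absolutely_continuous_on J G ->
  (forall x l, c < x -> x < d -> is_derive x 1 G l -> 0 <= l) ->
  G c <= G d.
Proof.
move=> cd cdJ acG G'.
pose Gc : R -> R := G \o clamp R c d.
have acGc : list_absolutely_continuous R Gc by exact: list_ac_clamp acG.
pose T x := fine (total_variation c (clamp R c d x) Gc).
have [acT TG] := list_ac_total_variation R Gc c d cd acGc; rewrite -/T in acT TG.
have clampK x : clamp R c d (clamp R c d x) = clamp R c d x.
  by rewrite clamp_id// clamp_itv.
have TGc x y : x <= y -> `|Gc y - Gc x| <= T y - T x.
  move=> xy; have /andP[cx xd] := clamp_itv R c d x cd.
  have /andP[cy yd] := clamp_itv R c d y cd.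
  have := TG _ _ cx (le_clamp R c d x y xy) yd.
  by rewrite /T /Gc /= !clampK.
have ndT : {homo T : x y / x <= y}.
  by move=> x y xy; rewrite -subr_ge0; apply: le_trans (TGc _ _ xy).
pose T' x := T x - Gc x.
have ndT' : {homo T' : x y / x <= y}.
  move=> x y xy; rewrite /T'; have := le_trans (ler_norm _) (TGc _ _ xy); lra.
have acT' : list_absolutely_continuous R T'.
  move=> e e0; have [r r0 Hr] := acT (e / 2) ltac:(lra).
  exists r => // s nos lens.
  have -> : e = e / 2 + e / 2 by lra.
  apply: (@le_trans _ _ (\sum_(p <- s) (`|T p.2 - T p.1| + `|T p.2 - T p.1|))).
    rewrite !big_seq; apply: ler_sum => p ps.
    have p12 : p.1 <= p.2 by move/andP : nos => [/allP/(_ p ps)].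
    rewrite (_ : T' p.2 - T' p.1 = (T p.2 - T p.1) - (Gc p.2 - Gc p.1)); last first.
      by rewrite /T'; ring.
    apply: le_trans (ler_normB _ _) _; apply: lerD => //.
    exact: le_trans (TGc _ _ p12) (ler_norm _).
  by rewrite big_split; apply: lerD; exact: Hr.
have [h1 h1i h1E] := monotone_ac_density R T c d ndT acT.
have [h2 h2i h2E] := monotone_ac_density R T' c d ndT' acT'.
pose g x := h1 x - h2 x.
have gi : (@lebesgue_measure R).-integrable setT (EFin \o g).
  exact: (integrableB measurableT h1i h2i).
pose F x := \int[@lebesgue_measure R]_(t in `]c, x]) g t.
have FE x : c <= x <= d -> G x - G c = F x.
  move=> cxd; rewrite /F RintegralB//; [|exact: integrableS h1i|exact: integrableS h2i].
  rewrite -h1E// -h2E// /T' /Gc /= !clamp_id// ?lexx ?cd//; ring.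
have giS (i : interval R) :
    (@lebesgue_measure R).-integrable [set` i] (EFin \o g).
  exact: integrableS gi.
(* Almost everywhere on []c, d[], [F] has derivative [g]; there [G] is [F] plus a constant, so the
   hypothesis on derivatives of [G] gives the sign of [g]. *)
have aeF := @FTC1 R g (BRight c) (fun y => giS _)
  (open_integrable_locally openT gi).
have aeg : {ae @lebesgue_measure R, forall x, c < x < d -> 0 <= g x}.
  move: aeF; apply: filterS; first exact: (ae_filter_ringOfSetsType (@lebesgue_measure R)).
  move=> x + /andP[cx xd]; rewrite lte_fin => /(_ cx).
  rewrite -/F => -[Fx Fg].
  apply: (G' x) => //.
  apply: (@near_eq_is_derive _ _ _ (F \+ cst (G c))).
    near=> y; rewrite /= -FE ?subrK//.
    have : y \in `]c, d[ by near: y; apply: near_in_itvoo; rewrite in_itv /= cx.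
    by rewrite in_itv /= => /andP[/ltW-> /ltW->].
  rewrite -Fg derive1E -[X in is_derive _ _ _ X]addr0.
  by apply: is_deriveD; exact: derivableP.
suff : 0 <= F d by rewrite -FE ?cd ?lexx// subr_ge0.
rewrite /F -Rintegral_itv_bndo_bndc; last exact: integrableS gi.
(* The sign of [g] is known only almost everywhere on the open interval, while [integral_ge0] asks
   for it at every point: [g] is replaced by its absolute value. *)
rewrite /Rintegral (_ : (\int[_]_(x in _) _)%E =
    (\int[@lebesgue_measure R]_(x in `]c, d[) `|g x|%:E)%E); last first.
  have mg : measurable_fun (`]c, d[%classic : set (measurableTypeR R)) g.
    by apply/measurable_EFinP; apply: measurable_int; apply: integrableS gi.
  apply: ae_eq_integral => //.
  - exact/measurable_EFinP.
  - by apply/measurable_EFinP; exact: measurableT_comp.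
  - move: aeg; apply: filterS; first exact: (ae_filter_ringOfSetsType (@lebesgue_measure R)).
    move=> x gx /=; rewrite in_itv /= => /gx g0.
    by rewrite ger0_norm.
by apply: fine_ge0; apply: integral_ge0 => x _; rewrite lee_fin.
Unshelve. all: by end_near. Qed.

(** * Differentiation rules and comparison through derivatives *)

Lemma is_derive_shift (R : realType) (f : R -> R) (c s l : R) :
  is_derive (c + s) 1 f l -> is_derive s 1 (fun r => f (c + r)) l.
Proof.
move=> df; rewrite -[l]mulr1; apply: (@is_derive1_comp _ f (fun r => c + r)) => //.
rewrite -[X in is_derive _ _ _ X]add0r.
exact: (@is_deriveD _ _ _ (cst c) id).
Qed.

Lemma is_derive_reflect (R : realType) (f : R -> R) (c s l : R) :
  is_derive (c - s) 1 f l -> is_derive s 1 (fun r => f (c - r)) (- l).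
Proof.
move=> df; rewrite -[l]mulr1 -mulrN.
apply: (@is_derive1_comp _ f (fun r => c - r)) => //.
rewrite -[X in is_derive _ _ _ X]add0r.
exact: (@is_deriveB _ _ _ (cst c) id).
Qed.

Lemma is_derive_addfun (R : realType) (f g : R -> R) (s l k : R) :
  is_derive s 1 f l -> is_derive s 1 g k ->
  is_derive s 1 (fun r => f r + g r) (l + k).
Proof. exact: is_deriveD. Qed.

Lemma is_derive_subfun (R : realType) (f g : R -> R) (s l k : R) :
  is_derive s 1 f l -> is_derive s 1 g k ->
  is_derive s 1 (fun r => f r - g r) (l - k).
Proof. exact: is_deriveB. Qed.

Lemma is_derive_mulfun (R : realType) (f g : R -> R) (s l k : R) :
  is_derive s 1 f l -> is_derive s 1 g k ->
  is_derive s 1 (fun r => f r * g r) (f s * k + g s * l).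
Proof. exact: is_deriveM. Qed.

Lemma is_derive_lnfun (R : realType) (f : R -> R) (s l : R) :
  0 < f s -> is_derive s 1 f l ->
  is_derive s 1 (fun r => ln (f r)) ((f s)^-1 * l).
Proof. by move=> f0; apply: is_derive1_comp; exact: is_derive1_ln. Qed.

Lemma is_derive_const (R : realType) (c s : R) :
  is_derive s 1 (fun _ : R => c) 0.
Proof. exact: is_derive_cst. Qed.

Lemma is_derive_var (R : realType) (s : R) : is_derive s 1 (fun r : R => r) 1.
Proof. exact: is_derive_id. Qed.

(** Lets [derive_tac] compute the derivative as an existential variable, to be compared with the
    desired value afterwards. *)
Lemma is_derive_value (R : realType) (f : R -> R) (s l : R) :
  (exists2 l', is_derive s 1 f l' & l' = l) -> is_derive s 1 f l.
Proof. by case=> l' df <-. Qed.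

(* [is_derive] is a class: typeclass resolution would fill the premises with
   library instances whose derivatives are stated with [*:], which [ring] and
   [field] do not recognize. *)
Ltac derive_tac :=
  lazymatch goal with
  | |- is_derive _ _ (fun x => x) _ =>
      notypeclasses refine (is_derive_var _ _)
  | |- is_derive _ _ (fun _ => ?c) _ =>
      notypeclasses refine (is_derive_const _ _ _)
  | |- is_derive _ _ (fun x => @?f x - @?g x) _ =>
      notypeclasses refine (is_derive_subfun _ f g _ _ _ _ _);
      derive_tac
  | |- is_derive _ _ (fun x => @?f x + @?g x) _ =>
      notypeclasses refine (is_derive_addfun _ f g _ _ _ _ _);
      derive_tac
  | |- is_derive _ _ (fun x => @?f x * @?g x) _ =>
      notypeclasses refine (is_derive_mulfun _ f g _ _ _ _ _);
      derive_tac
  | |- is_derive _ _ (fun x => ln (@?f x)) _ =>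
      notypeclasses refine (is_derive_lnfun _ f _ _ _ _);
      [|derive_tac]
  | |- is_derive _ _ _ _ => eassumption
  | _ => idtac
  end.

Lemma nonneg_derive_le (R : realType) (g g' : R -> R) (x y : R) : x <= y ->
  (forall r, x <= r <= y -> is_derive r 1 g (g' r)) ->
  (forall r, x <= r <= y -> 0 <= g' r) -> g x <= g y.
Proof.
move=> xy dg g'0; have [||c] := @MVT_segment R g g' x y xy.
- by move=> r; rewrite in_itv /= => /andP[/ltW xr /ltW ry]; apply: dg; rewrite xr.
- apply: derivable_within_continuous => r; rewrite in_itv /= => rxy.
  by have [] := dg r rxy.
- rewrite in_itv /= => cxy e; rewrite -subr_ge0 e mulr_ge0 ?subr_ge0//.
  exact: g'0.
Qed.

(** Both [w - p] and [w + p] have nonnegative derivatives and vanish at [x]. *)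
Lemma abs_derive_le (R : realType) (p p' w w' : R -> R) (x y : R) : x <= y ->
  p x = 0 -> w x = 0 ->
  (forall r, x <= r <= y -> is_derive r 1 p (p' r)) ->
  (forall r, x <= r <= y -> is_derive r 1 w (w' r)) ->
  (forall r, x <= r <= y -> `|p' r| <= w' r) -> `|p y| <= w y.
Proof.
move=> xy p0 w0 dp dw pw.
have h1 : w x - p x <= w y - p y.
  apply: (@nonneg_derive_le R (fun r => w r - p r) (fun r => w' r - p' r)) => //.
    by move=> r rxy; apply: is_derive_subfun; [exact: dw|exact: dp].
  by move=> r rxy; rewrite subr_ge0; exact: le_trans (ler_norm _) (pw r rxy).
have h2 : w x + p x <= w y + p y.
  apply: (@nonneg_derive_le R (fun r => w r + p r) (fun r => w' r + p' r)) => //.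
    by move=> r rxy; apply: is_derive_addfun; [exact: dw|exact: dp].
  by move=> r rxy; have := pw r rxy; rewrite ler_norml => /andP[]; lra.
by rewrite ler_norml; apply/andP; split; lra.
Qed.

(** * The error of the corrected trapezoid rule *)

Lemma cvg_at_left_shift (R : realType) (f : R -> R) (c k l : R) :
  f x @[x --> (c + k)^'-] --> l -> f (c + s) @[s --> k^'-] --> l.
Proof.
move=> fl P /fl [e /= e0 eP]; exists e => //= s ks sk; apply: eP.
  by rewrite /ball_ /= (_ : c + k - (c + s) = k - s)//; ring.
by rewrite ltrD2l.
Qed.

Lemma cvg_at_left_reflect (R : realType) (f : R -> R) (c k l : R) :
  f x @[x --> (c - k)^'+] --> l -> f (c - s) @[s --> k^'-] --> l.
Proof.
move=> fl P /fl [e /= e0 eP]; exists e => //= s ks sk; apply: eP.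
  rewrite /ball_ /= (_ : c - k - (c - s) = - (k - s)) ?normrN//; ring.
by rewrite ltrD2l ltrN2.
Qed.

(* The right-hand side is [s * n s - \int_0^s n], for
   [n r = C * (ln (k + r) - ln (k - r)) + 2 * be * r]. *)
Lemma second_difference_bound (R : realType) (f1 f2 : R -> R)
    (m k C be s : R) : 0 < k -> 0 <= s -> s < k ->
  (forall x, m - k < x < m + k -> is_derive x 1 f1 (f2 x)) ->
  (forall r, 0 <= r <= s ->
    `|f2 (m + r) + f2 (m - r) - (f2 (m + s) + f2 (m - s))| <=
    C * (ln (k + s) - ln (k - s)) + 2 * be * s
    - (C * (ln (k + r) - ln (k - r)) + 2 * be * r)) ->
  `|f1 (m + s) - f1 (m - s) - s * (f2 (m + s) + f2 (m - s))| <=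
    be * (s * s) - C * k * ln (1 - s * s / (k * k)).
Proof.
move=> k0 s0 sk df1 f2n.
pose n r := C * (ln (k + r) - ln (k - r)) + 2 * be * r.
(* Since [W' r = r * n' r], the function [r * n r - W r] is the primitive of [n] vanishing at 0. *)
pose W r := be * (r * r) - C * k * ln (1 - r * r / (k * k)).
(* The value of [f2] at [m + s] and [m - s] is frozen: [P s] is the quantity to bound, and [P'] is
   the difference controlled by the hypothesis. Correspondingly [Q' r = n s - n r], and
   [Q s = W s]. *)
pose P r := f1 (m + r) - f1 (m - r) - r * (f2 (m + s) + f2 (m - s)).
pose Q r := r * n s - r * n r + W r.
have -> : be * (s * s) - C * k * ln (1 - s * s / (k * k)) = Q s.
  by (rewrite /Q /W; ring).
have dfp r : 0 <= r <= s -> is_derive r 1 (fun x => f1 (m + x)) (f2 (m + r)).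
  by move=> /andP[? ?]; apply: is_derive_shift; apply: df1; (apply/andP; split; lra).
have dfm r : 0 <= r <= s -> is_derive r 1 (fun x => f1 (m - x)) (- f2 (m - r)).
  by move=> /andP[? ?]; apply: is_derive_reflect; apply: df1; (apply/andP; split; lra).
apply: (@abs_derive_le R P (fun r => f2 (m + r) + f2 (m - r) - (f2 (m + s) + f2 (m - s)))
   Q (fun r => n s - n r) 0 s s0).
- by rewrite /P addr0 subr0 subrr mul0r subrr.
- by rewrite /Q /W !mul0r subrr !mulr0 subr0 ln1 mulr0 subr0 addr0.
- move=> r rs; have dfpr := dfp r rs; have dfmr := dfm r rs.
  apply: is_derive_value; eexists; first by rewrite /P; derive_tac.
  rewrite /=; ring.
- move=> r /andP[r0 rs]; apply: is_derive_value; eexists.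
  rewrite /Q /n /W; derive_tac; rewrite /=; [lra|lra|].
  rewrite subr_gt0 ltr_pdivrMr ?mulr_gt0// mul1r.
  by apply: ltr_pM => //; lra.
  rewrite /= /n; field.
  have h1 : k - r != 0 by rewrite gt_eqF//; lra.
  have h2 : k + r != 0 by rewrite gt_eqF//; lra.
  rewrite (gt_eqF k0) h1 h2 /=.
  by rewrite (_ : k ^+ 2 - r ^+ 2 = (k - r) * (k + r)) ?mulf_neq0//; ring.
- exact: f2n.
Qed.

Lemma trapezoid_interior_bound (R : realType) (F f f1 f2 : R -> R)
    (m k C be s : R) : 0 < k -> 0 <= C -> 0 <= be -> 0 <= s -> s < k ->
  (forall x, m - k < x < m + k -> is_derive x 1 F (f x)) ->
  (forall x, m - k < x < m + k -> is_derive x 1 f (f1 x)) ->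
  (forall x, m - k < x < m + k -> is_derive x 1 f1 (f2 x)) ->
  (forall r, 0 <= r -> r < k ->
    `|f1 (m + r) - f1 (m - r) - r * (f2 (m + r) + f2 (m - r))| <=
    be * (r * r) - C * k * ln (1 - r * r / (k * k))) ->
  `|s * (f (m + s) + f (m - s)) - (F (m + s) - F (m - s))
    - 3^-1 * (s * s) * (f1 (m + s) - f1 (m - s))| <=
  3^-1 * (C * k ^+ 3 / 2 + be * k ^+ 4 / 4).
Proof.
move=> k0 C0 be0 s0 sk dF df df1 D.
pose w r := 1 - r * r / (k * k).
have w01 r : 0 <= r -> r < k -> 0 < w r <= 1.
  move=> r0 rk; rewrite /w subr_gt0 ltr_pdivrMr ?mulr_gt0// mul1r.
  rewrite gerBl divr_ge0 ?mulr_ge0 ?(ltW k0)// andbT.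
  exact: ltr_pM.
(* [Z] is the primitive of [s / 3] times the bound on [D]. *)
pose Z r := 3^-1 * (C * k ^+ 3 / 2 * (w r * ln (w r) - w r + 1)
                    + be / 4 * (r * r * (r * r))).
apply: (@le_trans _ _ (Z s)); last first.
  (* The logarithm is singular at [s = k] but its primitive is not: [w * ln w - w + 1 <= 1] for
     [0 < w <= 1]. The resulting bound is uniform in [s]. *)
  have /andP[ws0 ws1] := w01 s s0 sk.
  rewrite /Z ler_pM2l ?invr_gt0//; apply: lerD.
    rewrite -[leRHS]mulr1 ler_wpM2l//.
      by rewrite divr_ge0// mulr_ge0// exprn_ge0// ltW.
    have : w s * ln (w s) <= 0 by rewrite mulr_ge0_le0 ?(ltW ws0)// ln_le0.
    lra.
  have sk4 : s ^+ 4 <= k ^+ 4 by rewrite lerXn2r ?nnegrE// ltW.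
  rewrite (_ : be * k ^+ 4 / 4 = be / 4 * k ^+ 4); last by ring.
  rewrite ler_wpM2l ?divr_ge0//; apply: le_trans sk4.
  by rewrite le_eqVlt; apply/orP; left; apply/eqP; ring.
pose E r := r * (f (m + r) + f (m - r)) - (F (m + r) - F (m - r))
    - 3^-1 * (r * r) * (f1 (m + r) - f1 (m - r)).
apply: (@abs_derive_le R E (fun r => 3^-1 * r *
  (f1 (m + r) - f1 (m - r) - r * (f2 (m + r) + f2 (m - r)))) Z
  (fun r => 3^-1 * r * (be * (r * r) - C * k * ln (w r))) 0 s s0).
- by rewrite /E (addr0 m) (subr0 m); ring.
- by rewrite /Z /w !mul0r subr0 ln1; ring.
- move=> r /andP[r0 rs].
  have dp (g g' : R -> R) : (forall x, m - k < x < m + k -> is_derive x 1 g (g' x)) ->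
    is_derive r 1 (fun x => g (m + x)) (g' (m + r)).
    move=> dg; apply: is_derive_shift; apply: dg; apply/andP; split; lra.
  have dm (g g' : R -> R) : (forall x, m - k < x < m + k -> is_derive x 1 g (g' x)) ->
    is_derive r 1 (fun x => g (m - x)) (- g' (m - r)).
    move=> dg; apply: is_derive_reflect; apply: dg; apply/andP; split; lra.
  have dFp := dp _ _ dF; have dFm := dm _ _ dF.
  have dfp := dp _ _ df; have dfm := dm _ _ df.
  have df1p := dp _ _ df1; have df1m := dm _ _ df1.
  apply: is_derive_value; eexists; first by rewrite /E; derive_tac.
  by rewrite /=; field.
- move=> r /andP[r0 rs].
  have /andP[wr0 _] := w01 r r0 (le_lt_trans rs sk).
  have wr0' : w r != 0 by rewrite gt_eqF.
  apply: is_derive_value; eexists.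
    by rewrite /Z /w; derive_tac; rewrite /=; exact: wr0.
  move: wr0'; rewrite /= /w => wr0'; field.
  by rewrite (gt_eqF k0) subr_eq0 gt_eqF// ltr_pM//; exact: le_lt_trans rs sk.
- move=> r /andP[r0 rs]; rewrite normrM ger0_norm ?mulr_ge0// ler_wpM2l ?mulr_ge0//.
  by apply: D => //; exact: le_lt_trans rs sk.
Qed.

(** The logarithms blow up at [k], so [trapezoid_interior_bound] is used for [s < k] and [s] tends
    to [k]. The error contains no [f2], hence continuity of [f], [f1] and the integral up to the
    endpoints suffices. *)
Lemma trapezoid_bound (R : realType) (f f1 f2 : R -> R) (m k C be : R) :
  0 < k -> 0 <= C -> 0 <= be ->
  {within `[m - k, m + k], continuous f} ->
  {within `[m - k, m + k], continuous f1} ->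
  (forall x, m - k < x < m + k -> is_derive x 1 f (f1 x)) ->
  (forall x, m - k < x < m + k -> is_derive x 1 f1 (f2 x)) ->
  (forall r s, 0 <= r -> r <= s -> s < k ->
    `|f2 (m + r) + f2 (m - r) - (f2 (m + s) + f2 (m - s))| <=
    C * (ln (k + s) - ln (k - s)) + 2 * be * s
    - (C * (ln (k + r) - ln (k - r)) + 2 * be * r)) ->
  `|k * (f (m + k) + f (m - k))
    - \int[@lebesgue_measure R]_(x in `[m - k, m + k]) f x
    - 3^-1 * (k * k) * (f1 (m + k) - f1 (m - k))| <=
  3^-1 * (C * k ^+ 3 / 2 + be * k ^+ 4 / 4).
Proof.
move=> k0 C0 be0 cf cf1 df df1 f2n.
have ab : m - k < m + k by lra.
have intf : (@lebesgue_measure R).-integrable `[m - k, m + k] (EFin \o f).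
  by apply: continuous_compact_integrable => //; exact: segment_compact.
pose F x := \int[@lebesgue_measure R]_(t in `[m - k, x]) f t.
have [_ fa fb] := (continuous_within_itvP _ ab).1 cf.
have [_ f1a f1b] := (continuous_within_itvP _ ab).1 cf1.
have dF x : m - k < x < m + k -> is_derive x 1 F (f x).
  move=> /[dup] xab /andP[ax xb].
  have fx : {for x, continuous f}.
    by have [dfx _] := df x xab; apply/differentiable_continuous/derivable1_diffP.
  have [Fx FE] := continuous_FTC1_closed xb intf ax fx.
  by rewrite -FE derive1E; exact: derivableP.
have Fb : F x @[x --> (m + k)^'-] --> F (m + k).
  exact: parameterized_integral_cvg_at_left ab intf.
have Fa : F x @[x --> (m - k)^'+] --> 0.
  by apply: cvg_at_right_filter; exact: parameterized_integral_cvg_left ab intf.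
pose E r := r * (f (m + r) + f (m - r)) - (F (m + r) - F (m - r))
    - 3^-1 * (r * r) * (f1 (m + r) - f1 (m - r)).
have idk : id s @[s --> k^'-] --> k by exact: cvg_at_left_filter.
have Ek : E s @[s --> k^'-] --> k * (f (m + k) + f (m - k)) - (F (m + k) - 0)
    - 3^-1 * (k * k) * (f1 (m + k) - f1 (m - k)).
  apply: cvgB; first apply: cvgB.
  - apply: cvgM => //; apply: cvgD; first exact: cvg_at_left_shift.
    exact: cvg_at_left_reflect.
  - by apply: cvgB; [exact: cvg_at_left_shift|exact: cvg_at_left_reflect].
  - apply: cvgM; first by apply: cvgM; [exact: cvg_cst|exact: cvgM].
    by apply: cvgB; [exact: cvg_at_left_shift|exact: cvg_at_left_reflect].
rewrite -/(F (m + k)) -[F (m + k)]subr0.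
apply: (cvgr_to_le (cvg_norm Ek)).
near=> s.
have s0 : 0 < s by near: s; exact: nbhs_left_gt.
have sk : s < k by near: s; exact: nbhs_left_lt.
apply: (@trapezoid_interior_bound R F f f1 f2 m k C be s) => //; first exact: ltW.
move=> r r0 rk; apply: second_difference_bound => // t /andP[t0 tr].
exact: f2n.
Unshelve. all: by end_near. Qed.

(** * Tangent lines to powers *)

(** For [z > 0], write [z ^ q = z * exp ((q - 1) * ln z)], which is at least
    [z * (1 + (q - 1) * ln z)], and use [z * ln z >= z - 1]. *)
Lemma powR_bernoulli (R : realType) (q z : R) : 1 <= q -> 0 <= z ->
  1 + q * (z - 1) <= z `^ q.
Proof.
move=> q1; rewrite le_eqVlt => /orP[/eqP <-|z0].
  by rewrite powR0 ?gt_eqF//; lra.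
have lnz : z - 1 <= z * ln z.
  have := @le_ln1Dx R (z^-1 - 1); rewrite subrKC lnV ?posrE// => h.
  have zi0 : 0 < z^-1 by rewrite invr_gt0.
  have {h}h : - ln z <= z^-1 - 1 by apply: h; lra.
  have : z * - ln z <= z * (z^-1 - 1) by rewrite ler_pM2l.
  by rewrite mulrN mulrBr mulfV ?gt_eqF// mulr1; lra.
have -> : z `^ q = z * expR ((q - 1) * ln z).
  rewrite /powR; case: ifPn => [/eqP z00|_]; first by rewrite z00 ltxx in z0.
  by rewrite -{2}[z]lnK ?posrE// -expRD; congr expR; ring.
apply: (@le_trans _ _ (z * (1 + (q - 1) * ln z))); last first.
  by rewrite ler_pM2l// expR_ge1Dx.
have : (q - 1) * (z - 1) <= (q - 1) * (z * ln z) by rewrite ler_wpM2l//; lra.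
lra.
Qed.

(** Bernoulli's inequality at [z = y / t]. Equality holds at [y = t]: in the variable [Y = y ^ q]
    the right-hand side is the tangent to [Y ^ (1 / q)] at [t ^ q]. *)
Lemma powR_tangent (R : realType) (q t y : R) : 1 <= q -> 0 < t -> 0 <= y ->
  y <= t * (1 - q^-1) + t `^ (1 - q) / q * y `^ q.
Proof.
move=> q1 t0 y0; have q0 : 0 < q by lra.
have z0 : 0 <= y / t by rewrite divr_ge0// ltW.
have yE : y `^ q = (y / t) `^ q * t `^ q.
  by rewrite -(powRM _ z0 (ltW t0)) divfK// gt_eqF.
have tE : t `^ (1 - q) * t `^ q = t.
  rewrite -powRD; first by rewrite subrK powRr1// ltW.
  by apply/implyP => _; rewrite gt_eqF.
rewrite yE (_ : _ / q * _ = (t `^ (1 - q) * t `^ q) / q * (y / t) `^ q); last by ring.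
rewrite tE.
have : t / q * (1 + q * (y / t - 1)) <= t / q * (y / t) `^ q.
  by rewrite ler_wpM2l ?divr_ge0 ?(ltW t0) ?(ltW q0)// powR_bernoulli.
suff <- : y - t * (1 - q^-1) = t / q * (1 + q * (y / t - 1)) by lra.
by field; rewrite !gt_eqF.
Qed.

(* [y <= al * Y + be] is the tangent to [Y `^ (1 / q)] at [Y = 4 * (A + B)], the
   mean of [A / (1 - s) + B / s] for the weight [16 s (1 - s) |2 s - 1|] on
   [[0, 1]]: the tangent is then as sharp as the power mean inequality. *)
Lemma godunova_levin_majorant (R : realType) (q A B : R) :
  1 <= q -> 0 <= A -> 0 <= B ->
  exists al be : R, [/\ 0 <= al, 0 <= be,
    forall y u v, 0 <= y -> 0 <= u -> 0 <= v -> y `^ q <= A * u + B * v ->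
      y <= al * (A * u + B * v) + be &
    al * (A + B) / 4 + be / 16 =
      (1 / 16) `^ (1 - 1 / q) * ((A + B) / 4) `^ (1 / q)].
Proof.
move=> q1 A0 B0; have q0 : 0 < q by lra.
have qn0 : q != 0 by rewrite gt_eqF.
(* If [A + B = 0] the point of tangency degenerates, but then [y ^ q <= 0] forces [y = 0] and zero
   coefficients work. *)
have := addr_ge0 A0 B0; rewrite le_eqVlt => /orP[/eqP AB|AB].
  have AE : A = 0 by lra.
  have BE : B = 0 by lra.
  exists 0, 0; split => //.
    move=> y u v y0 _ _; rewrite AE BE !mul0r !addr0 => yq.
    have : y `^ q = 0 by apply/eqP; rewrite eq_le yq powR_ge0.
    by move/powR_eq0_eq0 => ->.
  by rewrite AE BE !addr0 !mul0r addr0 powR0 ?mulr0// div1r invr_eq0.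
pose t := (4 * (A + B)) `^ q^-1.
have t0 : 0 < t by apply: powR_gt0; rewrite mulr_gt0.
have tq : t `^ q = 4 * (A + B).
  by rewrite /t -powRrM mulVf// powRr1// mulr_ge0// ltW.
have tE : t `^ (1 - q) * t `^ q = t.
  rewrite -powRD; first by rewrite subrK powRr1// ltW.
  by apply/implyP => _; rewrite gt_eqF.
exists (t `^ (1 - q) / q), (t * (1 - q^-1)); split.
- by rewrite divr_ge0 ?powR_ge0 ?ltW.
- by rewrite mulr_ge0 ?(ltW t0)// subr_ge0 invf_le1.
- move=> y u v y0 u0 v0 yq; rewrite addrC.
  apply: le_trans (powR_tangent R q t y q1 t0 y0) _; rewrite lerD2l.
  by rewrite ler_wpM2l// divr_ge0 ?powR_ge0 ?ltW.
(* On the left, [t ^ q = 4 * (A + B)] turns the two terms into [t / (16 q)] and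
   [t (1 - 1 / q) / 16]; on the right, the powers of [1 / 16] combine. *)
- transitivity (t / 16).
    rewrite (_ : t `^ (1 - q) / q * (A + B) / 4 =
      (t `^ (1 - q) * (4 * (A + B))) / q / 16); last by field.
    by rewrite -tq tE; field.
  rewrite (_ : (A + B) / 4 = 1 / 16 * (4 * (A + B))); last by field.
  have AB4 : 0 <= 4 * (A + B) by rewrite mulr_ge0// ltW.
  have p16 : 0 <= 1 / 16 :> R by rewrite divr_ge0.
  rewrite (powRM _ p16 AB4) mulrA -powRD; last first.
    by apply/implyP => _; rewrite gt_eqF// divr_gt0.
  by rewrite subrK powRr1 ?divr_ge0// div1r [X in _ `^ X]div1r -/t mulrC.
Qed.

(** * Increments of absolutely continuous functions *)

(** [ac_increasing] applies to [N - g]: [N] is Lipschitz with constant [M], and wherever [N - g] has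
    a derivative [l], so does [g], with value [mu x - l]. *)
Lemma ac_derivative_le (R : realType) (J : set R) (g N mu : R -> R)
    (M u v : R) : u <= v -> 0 <= M ->
  (forall x, u <= x <= v -> J x) -> absolutely_continuous_on J g ->
  (forall x, u <= x <= v -> is_derive x 1 N (mu x)) ->
  (forall x, u <= x <= v -> `|mu x| <= M) ->
  (forall x l, u < x -> x < v -> is_derive x 1 g l -> l <= mu x) ->
  g v - g u <= N v - N u.
Proof.
move=> uv M0 uvJ acg dN muM gmu.
have lipN x y : u <= x -> x <= y -> y <= v -> `|N y - N x| <= M * (y - x).
  move=> ux xy yv.
  have inuv r : x <= r <= y -> u <= r <= v.
    by move=> /andP[xr ry]; apply/andP; split; lra.
  apply: (@abs_derive_le R (fun r => N r - N x) mu (fun r => M * (r - x))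
    (fun=> M) x y xy).
  - by rewrite subrr.
  - by rewrite subrr mulr0.
  - move=> r /inuv /dN dNr; apply: is_derive_value; eexists; first by derive_tac.
    by rewrite subr0.
  - move=> r _; apply: is_derive_value; eexists; first by derive_tac.
    by rewrite /=; ring.
  - by move=> r /inuv; exact: muM.
suff : N u - g u <= N v - g v by lra.
apply: (@ac_increasing R `[u, v]%classic (fun x => N x - g x)) => //.
  move=> e e0; have [d d0 H] := acg (e / 2) ltac:(lra).
  (* [M + 1] rather than [M], which may be zero. *)
  have Me0 : 0 < e / (2 * (M + 1)) by rewrite divr_gt0// mulr_gt0// ltr_wpDl.
  exists (Num.min d (e / (2 * (M + 1)))); first by rewrite lt_min d0.
  move=> n x y xy tI; rewrite lt_min => /andP[sd sM].
  have inJ i : [/\ u <= x i <= v, u <= y i <= v & x i < y i].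
    by have [] := xy i; rewrite /= !in_itv /=.
  have gS : \sum_(i < n) `|g (y i) - g (x i)| < e / 2.
    apply: H => //.
    by move=> i; have [? ? ?] := inJ i; split => //; exact: uvJ.
  have NS : \sum_(i < n) `|N (y i) - N (x i)| <= e / 2.
    apply: (@le_trans _ _ (\sum_(i < n) M * (y i - x i))).
      apply: ler_sum => i _; have [/andP[? ?] /andP[? ?] ?] := inJ i.
      by apply: lipN => //; exact: ltW.
    rewrite -mulr_sumr; apply: (@le_trans _ _ ((M + 1) * \sum_(i < n) (y i - x i))).
      rewrite ler_wpM2r ?lerDl//; apply: sumr_ge0 => i _.
      by rewrite subr_ge0 ltW//; have [] := inJ i.
    rewrite mulrC -ler_pdivlMr ?ltr_wpDl//.
    by rewrite -mulrA -invfM ltW.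
  have -> : e = e / 2 + e / 2 by lra.
  apply: le_lt_trans (ler_ltD NS gS); rewrite -big_split /=.
  apply: ler_sum => i _.
  rewrite (_ : _ - _ - _ = (N (y i) - N (x i)) - (g (y i) - g (x i))); last by ring.
  exact: ler_normB.
move=> x l ux xv dNg; have dNx : is_derive x 1 N (mu x).
  by apply: dN; rewrite (ltW ux) ltW.
have : is_derive x 1 g (mu x - l).
  apply: is_derive_value; exists (mu x - l) => //.
  have -> : g = (fun r => N r - (N r - g r)) by apply/funext => r; ring.
  exact: is_derive_subfun.
move=> /(gmu x _ ux xv); lra.
Qed.

Lemma ac_derivative_bound (R : realType) (J : set R) (g N mu : R -> R)
    (M u v : R) : u <= v -> 0 <= M ->
  (forall x, u <= x <= v -> J x) -> absolutely_continuous_on J g ->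
  (forall x, u <= x <= v -> is_derive x 1 N (mu x)) ->
  (forall x, u <= x <= v -> `|mu x| <= M) ->
  (forall x l, u < x -> x < v -> is_derive x 1 g l -> `|l| <= mu x) ->
  `|g v - g u| <= N v - N u.
Proof.
move=> uv M0 uvJ acg dN muM gmu; rewrite ler_norml; apply/andP; split; last first.
  apply: (@ac_derivative_le R J g N mu M) => // x l ux xv dg.
  exact: le_trans (ler_norm _) (gmu x l ux xv dg).
suff : - g v - - g u <= N v - N u by lra.
apply: (@ac_derivative_le R J (fun x => - g x) N mu M) => //.
  move=> e e0; have [d d0 H] := acg e e0; exists d => // n x y xy tI sd.
  rewrite (_ : \sum_(i < n) _ = \sum_(i < n) `|g (y i) - g (x i)|); first exact: H.
  by apply: eq_bigr => i _; rewrite -opprD normrN.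
move=> x l ux xv dg; apply: le_trans (ler_norm _) _; rewrite -normrN.
apply: (gmu x _ ux xv); have -> : g = (fun r => 0 - - g r).
  by apply/funext => r; ring.
apply: is_derive_value; exists (0 - l); last by rewrite sub0r.
exact: is_derive_subfun (is_derive_const R 0 x) dg.
Qed.

(** * Derivatives within an interval and two-sided derivatives *)

Lemma has_derivative_withinP (R : realType) (I : set R) (f : R -> R)
    (x l : R) :
  has_derivative_within I f x l <->
  forall e, 0 < e -> exists2 d, 0 < d & forall y, I y -> y != x ->
    `|y - x| < d -> `|l - (f y - f x) / (y - x)| <= e.
Proof.
split=> [H e e0|H].
  have /cvgrPdist_le/(_ e e0) [d /= d0 dP] := H.
  exists d => // y Iy yx ydx; apply: dP => //; by rewrite /= distrC.
apply/cvgrPdist_le => e e0; have [d d0 dP] := H e e0.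
by exists d => //= y ydx yx Iy; apply: dP => //; rewrite distrC.
Qed.

Lemma is_derive_epsilonP (R : realType) (f : R -> R) (x l : R) :
  is_derive x 1 f l <->
  forall e, 0 < e -> exists2 d, 0 < d & forall y, y != x ->
    `|y - x| < d -> `|l - (f y - f x) / (y - x)| <= e.
Proof.
split=> [[dfx dfl] e e0|H].
  have : h^-1 *: ((f \o shift x) (h *: 1) - f x) @[h --> 0^'] --> l.
    by rewrite -dfl; exact: dfx.
  move=> /cvgrPdist_le/(_ e e0) [d /= d0 dP].
  exists d => // y yx ydx; have := dP (y - x).
  rewrite /= sub0r normrN subr_eq0 => /(_ ydx yx).
  by rewrite /GRing.scale /= mulr1 subrK mulrC.
have cv : h^-1 *: ((f \o shift x) (h *: 1) - f x) @[h --> 0^'] --> l.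
  apply/cvgrPdist_le => e e0; have [d d0 dP] := H e e0.
  exists d => //= h; rewrite /= sub0r normrN => hd h0.
  have := dP (h + x); rewrite addrK => h'.
  rewrite /GRing.scale /= mulr1 mulrC; apply: h' => //.
  by apply: contra h0 => /eqP hx; rewrite -(addrK x h) hx subrr.
split; first by apply/cvg_ex; exists l.
exact/cvg_lim.
Qed.

Lemma has_derivative_within_is_derive (R : realType) (I : set R) (f : R -> R)
    (x l r : R) : 0 < r -> (forall y, `|y - x| < r -> I y) ->
  has_derivative_within I f x l <-> is_derive x 1 f l.
Proof.
move=> r0 rI; split.
  move=> /has_derivative_withinP H; apply/is_derive_epsilonP => e /H[d d0 dP].
  exists (Num.min d r); first by rewrite lt_min d0.
  by move=> y yx; rewrite lt_min => /andP[yd yr]; apply: dP => //; exact: rI.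
move=> /is_derive_epsilonP H; apply/has_derivative_withinP => e /H[d d0 dP].
by exists d => // y _; exact: dP.
Qed.

(** Near [x] the difference quotient within [I] is at distance at most 1 from [df x], so increments
    are at most [(|df x| + 1) * |y - x|]; this includes endpoints of [I]. *)
Lemma derivative_on_continuous (R : realType) (I A : set R) (f df : R -> R) :
  A `<=` I -> derivative_on I f df -> {within A, continuous f}.
Proof.
move=> AI fdf; apply/subspace_continuousP => x Ax.
have /has_derivative_withinP H := fdf x (AI x Ax).
apply/cvgrPdist_le => e e0.
have [d d0 dP] := H 1 ltr01.
have l0 : 0 < `|df x| + 1 by rewrite ltr_wpDl.
exists (Num.min d (e / (`|df x| + 1))) => /=.
  by rewrite lt_min d0 divr_gt0.
move=> y /=; rewrite lt_min => /andP[yd ye] Ay.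
have [->|yx] := eqVneq y x; first by rewrite subrr normr0 ltW.
have := dP y (AI y Ay) yx; rewrite [`|y - x|]distrC => /(_ yd) h.
rewrite distrC (_ : f y - f x = (f y - f x) / (y - x) * (y - x)); last first.
  by rewrite divfK// subr_eq0.
rewrite normrM; apply: (@le_trans _ _ ((`|df x| + 1) * `|y - x|)).
  rewrite ler_wpM2r//; set p := _ / _ in h *.
  have -> : p = df x - (df x - p) by ring.
  by apply: le_trans (ler_normB _ _) _; rewrite lerD2l.
by rewrite mulrC -ler_pdivlMr// distrC ltW.
Qed.

Theorem theorem3 (R : realType) (I : set R) (f f1 f2 f3 : R -> R) (a b q : R)
  (I_itv : is_interval I)
  (f1E : derivative_on I f f1)
  (f2E : derivative_on I f1 f2)
  (f2_ac : absolutely_continuous_on (interior I) f2)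
  (f3E : extends_derivative_on I f2 f3)
  (Ia : I a) (Ib : I b) (ab : a < b)
  (f3_L : (@lebesgue_measure R).-integrable `[a, b] (EFin \o f3))
  (q1 : 1 <= q)
  (f3_Q : godunova_levin I (fun x => `|f3 x| `^ q)) :
  `| (f a + f b) / 2
     - (b - a)^-1 * (\int[@lebesgue_measure R]_(x in `[a, b]) f x)
     - (b - a) / 12 * (f1 b - f1 a) |
  <= (b - a) ^+ 3 / 12 * (1 / 16) `^ (1 - 1 / q)
     * ((`|f3 a| `^ q + `|f3 b| `^ q) / 4) `^ (1 / q).
Proof.
set A := `|f3 a| `^ q; set B := `|f3 b| `^ q.
have A0 : 0 <= A by exact: powR_ge0.
have B0 : 0 <= B by exact: powR_ge0.
have [al [be [al0 be0 maj majE]]] := godunova_levin_majorant R q A B q1 A0 B0.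
pose h := b - a; have h0 : 0 < h by rewrite /h; lra.
have abI x : a <= x <= b -> I x by exact: I_itv.
have ballI x : a < x < b -> exists2 r, 0 < r & forall y, `|y - x| < r -> I y.
  move=> /andP[ax xb]; exists (Num.min (x - a) (b - x)).
    by rewrite lt_min; apply/andP; split; lra.
  move=> y; rewrite lt_min !ltr_norml => /andP[/andP[? ?] /andP[? ?]].
  by apply: abI; apply/andP; split; lra.
have intI x : a < x < b -> interior I x.
  move=> /ballI[r r0 rI]; exists r => //= y; rewrite /= distrC; exact: rI.
have df x : a < x < b -> is_derive x 1 f (f1 x).
  move=> /[dup] xab /ballI[r r0 rI].
  apply/(has_derivative_within_is_derive R I f x (f1 x) r r0 rI).
  by apply: f1E; apply: rI; rewrite subrr normr0.
have df1 x : a < x < b -> is_derive x 1 f1 (f2 x).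
  move=> /[dup] xab /ballI[r r0 rI].
  apply/(has_derivative_within_is_derive R I f1 x (f2 x) r r0 rI).
  by apply: f2E; apply: rI; rewrite subrr normr0.
pose mu x := al * (A * (h / (b - x)) + B * (h / (x - a))) + be.
have f3mu x : a < x < b -> `|f3 x| <= mu x.
  move=> /andP[ax xb].
  (* The weight [(b - x) / h] on [a] is the one for which the convex combination of [a] and [b]
     equals [x]. *)
  have u0 : 0 < (b - x) / h by rewrite divr_gt0//; lra.
  have u1 : (b - x) / h < 1 by rewrite ltr_pdivrMr// mul1r /h; lra.
  have bxn0 : b - x != 0 by rewrite gt_eqF//; lra.
  have xan0 : x - a != 0 by rewrite gt_eqF//; lra.
  have hn0 : b - a != 0 by rewrite gt_eqF.
  have [_ /(_ a b ((b - x) / h) Ia Ib u0 u1)] := f3_Q.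
  rewrite (_ : _ * a + _ * b = x); last by rewrite /h; field.
  rewrite (_ : 1 - (b - x) / h = (x - a) / h); last by rewrite /h; field.
  rewrite !invf_div => fx; apply: maj => //.
    by rewrite divr_ge0 ?(ltW h0)//; lra.
  by rewrite divr_ge0 ?(ltW h0)//; lra.
(* A primitive of [mu] on []a, b[]. *)
pose N x := al * h * (B * ln (x - a) - A * ln (b - x)) + be * x.
have f2N u v : a < u -> u <= v -> v < b -> `|f2 v - f2 u| <= N v - N u.
  move=> au uv vb.
  (* Each fraction of [mu] is largest at one end of [[u, v]]: the first at [v], the second at
     [u]. *)
  pose M := al * (A * (h / (b - v)) + B * (h / (u - a))) + be.
  have mu0 x : a < x < b -> 0 <= mu x.
    by move=> xab; apply: le_trans (f3mu x xab).
  have muM x : u <= x <= v -> `|mu x| <= M.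
    move=> /andP[ux xv]; rewrite ger0_norm; last first.
      by apply: mu0; apply/andP; split; lra.
    rewrite /mu /M lerD2r ler_wpM2l//; apply: lerD; rewrite ler_wpM2l//.
      by rewrite ler_pM2l// lef_pV2 ?posrE; lra.
    by rewrite ler_pM2l// lef_pV2 ?posrE; lra.
  have M0 : 0 <= M by apply: le_trans (normr_ge0 _) (muM u _); rewrite lexx uv.
  apply: (ac_derivative_bound R (interior I) f2 N mu M u v uv M0 _ f2_ac _ muM).
  - by move=> x /andP[ux xv]; apply: intI; apply/andP; split; lra.
  - move=> x /andP[ux xv]; apply: is_derive_value; eexists.
      by rewrite /N; derive_tac; rewrite /=; lra.
    rewrite /mu /=; field; apply/andP; split; rewrite gt_eqF//; lra.
  - move=> x l ux xv dl.
    have xab : a < x < b by apply/andP; split; lra.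
    have [r r0 rI] := ballI x xab.
    rewrite -(f3E x l); first exact: f3mu.
      by apply: rI; rewrite subrr normr0.
    exact/(has_derivative_within_is_derive R I f2 x l r r0 rI).
pose m := (a + b) / 2; pose k := h / 2.
have k0 : 0 < k by rewrite /k divr_gt0.
have mka : m - k = a by rewrite /m /k /h; field.
have mkb : m + k = b by rewrite /m /k /h; field.
have abS : `[a, b]%classic `<=` I by move=> x; rewrite /= in_itv; exact: abI.
have := @trapezoid_bound R f f1 f2 m k (al * h * (A + B)) be k0.
rewrite mka mkb => /(_ _ be0 (derivative_on_continuous R I _ f f1 abS f1E)
  (derivative_on_continuous R I _ f1 f2 abS f2E) df df1).
have C0 : 0 <= al * h * (A + B).
  by rewrite mulr_ge0 ?addr_ge0// mulr_ge0// ltW.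
(* Reflection in [m] exchanges [x - a] and [b - x], so in the sum of the increments of [N] on both
   sides [A] and [B] enter only through [A + B]. *)
have f2n r s : 0 <= r -> r <= s -> s < k ->
    `|f2 (m + r) + f2 (m - r) - (f2 (m + s) + f2 (m - s))| <=
    al * h * (A + B) * (ln (k + s) - ln (k - s)) + 2 * be * s
    - (al * h * (A + B) * (ln (k + r) - ln (k - r)) + 2 * be * r).
  move=> r0 rs sk.
  have h1 : `|f2 (m + s) - f2 (m + r)| <= N (m + s) - N (m + r).
    by apply: f2N; lra.
  have h2 : `|f2 (m - r) - f2 (m - s)| <= N (m - r) - N (m - s).
    by apply: f2N; lra.
  have -> : f2 (m + r) + f2 (m - r) - (f2 (m + s) + f2 (m - s)) =
    (f2 (m - r) - f2 (m - s)) - (f2 (m + s) - f2 (m + r)) by ring.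
  apply: le_trans (ler_normB _ _) _; apply: le_trans (lerD h2 h1) _.
  rewrite /N -[in leLHS]mka -[in leLHS]mkb.
  have e1 x : m + x - (m - k) = k + x by ring.
  have e2 x : m + k - (m + x) = k - x by ring.
  have e3 x : m - x - (m - k) = k - x by ring.
  have e4 x : m + k - (m - x) = k + x by ring.
  rewrite !(e3, e4, e1, e2) le_eqVlt; apply/orP; left; apply/eqP; ring.
move=> /(_ C0 f2n) H.
(* The target becomes [h ^ 3 / 12 * (al * (A + B) / 4 + be / 16)], which is exactly the bound [H]
   divided by [h], for [h = 2 * k]. *)
rewrite -[leRHS]mulrA -majE.
have kE : h = 2 * k by rewrite /k; field.
rewrite -/h; set J := \int[@lebesgue_measure R]_(x in `[a, b]) f x in H *.
have -> : (f a + f b) / 2 - h^-1 * J - h / 12 * (f1 b - f1 a) =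
    h^-1 * (k * (f b + f a) - J - 3^-1 * (k * k) * (f1 b - f1 a)).
  by rewrite kE; field; rewrite gt_eqF.
rewrite normrM gtr0_norm ?invr_gt0// mulrC ler_pdivrMr//.
apply: le_trans H _; rewrite le_eqVlt; apply/orP; left; apply/eqP.
by rewrite kE; field.
Qed.
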